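(* Let $f:\mathbb R^n\to\mathbb R$ be differentiable and convex. A point $\bar x\in\Omega$ is B-stationary for $\min_{x\in\Omega}f(x)$ if and only if it is a local minimizer of $\min_{x\in\Omega}f(x)$.
   Context: Let $n_0\ge0$, $m\ge1$ be integers, $n=n_0+2m$, and write $x=(x_0,x_1,x_2)\in\mathbb R^{n_0}\times\mathbb R^m\times\mathbb R^m$ for $x\in\mathbb R^n$. Fix matrices $A,B$ and vectors $a,b$ of compatible dimensions; vector inequalities are componentwise. The feasible set is $\Omega=\{x\in\mathbb R^n: Ax-a=0,\ Bx-b\ge0,\ x_1\ge0,\ x_2\ge0,\ x_{1,i}x_{2,i}=0\ \text{for } i=1,\dots,m\}$. The Bouligand tangent cone of $S\subseteq\mathbb R^n$ at $\bar x\in S$ is $T_S(\bar x)=\{d\in\mathbb R^n:\exists\,t_\ell\downarrow0,\ d^\ell\to d,\ \bar x+t_\ell d^\ell\in S\}$. A point $\bar x\in\Omega$ is B-stationary for $\min_\Omega f$ if $\nabla f(\bar x)^{\mathsf T}d\ge0$ for all $d\in T_\Omega(\bar x)$. *)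

(* Defs.v *)
From mathcomp Require Import all_boot all_order all_algebra.
From mathcomp Require Import all_classical all_reals topology normedtype.
From mathcomp Require Import derive convex.

Set Implicit Arguments.
Unset Strict Implicit.
Unset Printing Implicit Defensive.

Import Order.TTheory GRing.Theory Num.Theory.
Import numFieldNormedType.Exports.

Local Open Scope classical_set_scope.
Local Open Scope ring_scope.

(* R^n is the type of column vectors with the library's sup norm; the notions
   below depend only on the topology, hence not on the choice of norm. *)

Definition gradient (R : realType) (n : nat) (f : 'cV[R]_n -> R)
    (x : 'cV[R]_n) : 'cV[R]_n :=
  \col_i 'D_(delta_mx i 0 : 'cV[R]_n) f x.

(* [t_l decreases to 0] is read in the usual sense of optimization: t_l > 0 and
   t_l --> 0. Asking in addition for monotonicity gives the same cone, by
   passing to a subsequence. *)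
Definition tangent_cone (R : realType) (n : nat) (S : set 'cV[R]_n)
    (x : 'cV[R]_n) : set 'cV[R]_n :=
  [set d | exists (t : nat -> R) (ds : nat -> 'cV[R]_n),
     [/\ forall l, 0 < t l,
         t @ \oo --> (0 : R),
         ds @ \oo --> d
       & forall l, S (x + t l *: ds l)]].

Definition B_stationary (R : realType) (n : nat) (f : 'cV[R]_n -> R)
    (S : set 'cV[R]_n) (x : 'cV[R]_n) : Prop :=
  S x /\
  forall d, tangent_cone S x d -> 0 <= ((gradient f x)^T *m d) 0 0.

Definition local_minimizer (R : realType) (n : nat) (f : 'cV[R]_n -> R)
    (S : set 'cV[R]_n) (x : 'cV[R]_n) : Prop :=
  S x /\ \forall y \near x, S y -> f x <= f y.

(* The blocks of x = (x_0, x_1, x_2) in R^n0 * R^m * R^m; x_0 carries no sign or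
   complementarity constraint, so only x_1 and x_2 are named. *)
Definition part1 (R : realType) (n0 m : nat) (x : 'cV[R]_(n0 + (m + m))) :
  'cV[R]_m := usubmx (dsubmx x).
Definition part2 (R : realType) (n0 m : nat) (x : 'cV[R]_(n0 + (m + m))) :
  'cV[R]_m := dsubmx (dsubmx x).

Definition feasible_set (R : realType) (n0 m p q : nat)
    (A : 'M[R]_(p, n0 + (m + m))) (a : 'cV[R]_p)
    (B : 'M[R]_(q, n0 + (m + m))) (b : 'cV[R]_q) :
    set 'cV[R]_(n0 + (m + m)) :=
  [set x | [/\ A *m x - a = 0,
               forall i, 0 <= (B *m x - b) i 0,
               forall i, 0 <= part1 x i 0,
               forall i, 0 <= part2 x i 0
             & forall i, part1 x i 0 * part2 x i 0 = 0]].

(* Main.v *)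
Require Import Defs.
From mathcomp Require Import all_boot all_order all_algebra.
From mathcomp Require Import all_classical all_reals topology normedtype.
From mathcomp Require Import derive convex.
From mathcomp Require Import interval_inference sequences lra.

Import Order.TTheory GRing.Theory Num.Theory.
Import numFieldNormedType.Exports.

Local Open Scope classical_set_scope.
Local Open Scope ring_scope.

(** A feasible y close to xbar has at least the nonzero coordinates of xbar, so
    the complementarity pattern of y is compatible with that of xbar and the
    whole segment from xbar to y is feasible. Hence y - xbar is a tangent
    direction, and convexity turns B-stationarity into f xbar <= f y. The
    converse does not depend on the structure of the feasible set. *)

Section ConvexBStationary.
Context {R : realType} {n : nat} (f : 'cV[R]_n -> R).
Implicit Types (x d : 'cV[R]_n) (S : set 'cV[R]_n).

(** Differentiability makes ['D_d f x] linear in [d], so expanding [d] in the standard basis yields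
    the partial derivatives. *)
Lemma gradient_mulE x d : differentiable f x ->
  ((gradient f x)^T *m d) 0 0 = 'D_d f x.
Proof.
move=> dfx; rewrite deriveE// [in RHS](matrix_sum_delta d) linear_sum mxE.
apply: eq_bigr => i _.
by rewrite big_ord1 linearZ !mxE -deriveE// mulrC.
Qed.

(** The chord estimates below control difference quotients for positive steps, hence the one-sided
    limit. *)
Lemma derivable_cvg_at_right x d : derivable f x d ->
  h^-1 * (f (x + h *: d) - f x) @[h --> 0^'+] --> 'D_d f x.
Proof.
move=> /cvg_dnbhs_at_right df.
by under eq_fun do rewrite (addrC x).
Qed.

Hypothesis f_convex : convex_function [set: 'cV[R]_n] f.

Lemma convex_function_le_chord x d t : 0 <= t -> t <= 1 ->
  f (x + t *: d) <= f x + t * (f (x + d) - f x).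
Proof.
move=> t0 t1.
have := f_convex (Itv01 t0 t1) (x + d) x; rewrite !in_setE => /(_ I I).
rewrite convRE/= /conv/= scalerDr addrAC -scalerDl unstable.add_onemK scale1r.
by rewrite /unstable.onem; lra.
Qed.

(** By the chord bound every difference quotient with step in []0, 1]] is at most the right-hand
    side; let the step tend to 0. *)
Lemma convex_derive_le x d : derivable f x d -> 'D_d f x <= f (x + d) - f x.
Proof.
move=> /derivable_cvg_at_right df; apply: (cvgr_to_le df); near=> h.
have h0 : 0 < h by near: h; exact: nbhs_right_gt.
have h1 : h <= 1 by near: h; exact: nbhs_right_le.
by rewrite mulrC ler_pdivrMr// lerBlDl mulrC convex_function_le_chord// ltW.
Unshelve. all: by end_near. Qed.

(* Convexity makes the difference quotient at [t l] a lower bound for the one at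
   any fixed [s >= t l], so that the limit in [l] only involves continuity of f. *)
Lemma local_minimizer_B_stationary S x : (forall y, differentiable f y) ->
  local_minimizer f S x -> B_stationary f S x.
Proof.
move=> f_diff [Sx fmin]; split=> // d [t [ds [t0 t_cvg ds_cvg St]]].
have y_cvg : x + t l *: ds l @[l --> \oo] --> x.
  rewrite -[X in _ --> X]addr0 -(scale0r d).
  by apply: cvgD; [exact: cvg_cst | exact: cvgZ].
have fxs (s : R) : 0 < s -> f x <= f (x + s *: d).
  move=> s0.
  have fs_cvg : f (x + s *: ds l) @[l --> \oo] --> f (x + s *: d).
    apply: continuous_cvg; first exact: differentiable_continuous.
    by apply: cvgD; [exact: cvg_cst | exact: cvgZr].
  apply: (cvgr_to_ge fs_cvg); near=> l.
  have ts : t l <= s by near: l; exact: cvgr_le t_cvg _ s0.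
  have fxy : f x <= f (x + t l *: ds l).
    have : S (x + t l *: ds l) by exact: St.
    by near: l; exact: y_cvg fmin.
  (* On the chord from [x] to [x + s *: ds l], the parameter [t l / s] gives the feasible point
     [x + t l *: ds l]. *)
  have ts0 : 0 < t l / s by rewrite divr_gt0.
  have := @convex_function_le_chord x (s *: ds l) _ (ltW ts0).
  rewrite ler_pdivrMr// mul1r scalerA divfK ?gt_eqF// => /(_ ts) /(le_trans fxy).
  by rewrite lerDl pmulr_rge0// subr_ge0.
rewrite gradient_mulE//.
apply: (cvgr_to_ge (derivable_cvg_at_right _ _ (diff_derivable (f_diff x)))).
near=> h; have h0 : 0 < h by near: h; exact: nbhs_right_gt.
by rewrite mulr_ge0 ?invr_ge0 ?subr_ge0 ?fxs ?ltW.
Unshelve. all: by end_near. Qed.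

Lemma B_stationary_local_minimizer S x : differentiable f x ->
  (\forall y \near x, S y -> forall t, 0 <= t -> t <= 1 ->
    S (x + t *: (y - x))) ->
  B_stationary f S x -> local_minimizer f S x.
Proof.
move=> dfx Sstar [Sx Bx]; split=> //; near=> y => Sy.
have segS : forall t, 0 <= t -> t <= 1 -> S (x + t *: (y - x)).
  by move: Sy; near: y.
rewrite -subr_ge0.
have := @convex_derive_le x (y - x) (diff_derivable dfx).
rewrite (addrC x) subrK => /(le_trans _); apply.
rewrite -gradient_mulE//; apply: Bx.
(* The steps [1 / (l + 1)] lie in []0, 1]], so with a constant direction all points stay on the
   segment from [x] to [y]. *)
exists harmonic, (fun=> y - x); split.
- by move=> l; exact: harmonic_gt0.
- exact: cvg_harmonic.
- exact: cvg_cst.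
- move=> l; apply: segS; first exact: harmonic_ge0.
  by rewrite /harmonic invf_le1 ?ler1n.
Unshelve. all: by end_near. Qed.

End ConvexBStationary.

(** A factor that vanishes at the [y] end also vanishes at the [x] end, by contraposition, hence
    along the whole segment. *)
Lemma complementary_segment (F : idomainType) (x1 x2 y1 y2 t : F) :
  y1 * y2 = 0 -> (x1 != 0 -> y1 != 0) -> (x2 != 0 -> y2 != 0) ->
  (x1 + t * (y1 - x1)) * (x2 + t * (y2 - x2)) = 0.
Proof.
move=> /eqP; rewrite mulf_eq0 => /orP[] /eqP-> x1y x2y.
- have [->|/x1y] := eqVneq x1 0; last by rewrite eqxx.
  by rewrite subrr mulr0 addr0 mul0r.
- have [->|/x2y] := eqVneq x2 0; last by rewrite eqxx.
  by rewrite subrr mulr0 addr0 mulr0.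
Qed.

Lemma coord_neq0_near (R : realType) (n : nat) (x : 'cV[R]_n) (i : 'I_n) :
  \forall y \near x, x i 0 != 0 -> (y : 'cV[R]_n) i 0 != 0.
Proof.
have [_|xi0] := eqVneq (x i 0) 0; first by near=> y.
near=> y => _; near: y.
by have /cvgr_neq0 := @coord_continuous R n 1 i 0 x; apply.
Unshelve. all: by end_near. Qed.

(** The affine constraints pass to segments by convexity; closeness of [y] to [x] serves
    complementarity. *)
Lemma feasible_set_segment_near (R : realType) (n0 m p q : nat)
    (A : 'M[R]_(p, n0 + (m + m))) (a : 'cV[R]_p)
    (B : 'M[R]_(q, n0 + (m + m))) (b : 'cV[R]_q)
    (x : 'cV[R]_(n0 + (m + m))) :
  feasible_set A a B b x ->
  \forall y \near x, feasible_set A a B b y -> forall t, 0 <= t -> t <= 1 ->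
    feasible_set A a B b (x + t *: (y - x)).
Proof.
move=> [Ax Bx x1 x2 _].
near=> y => -[Ay By y1 y2 y12] t t0 t1.
have xy : forall i, x i 0 != 0 -> y i 0 != 0.
  (* There are finitely many coordinates, so one neighbourhood of [x] suits them all. *)
  near: y; apply: filter_forall => i; exact: coord_neq0_near.
have seg_ge0 (u v : R) : 0 <= u -> 0 <= v -> 0 <= u + t * (v - u).
  by move=> u0 v0; nra.
split.
- rewrite mulmxDr -scalemxAr mulmxBr.
  move/eqP: Ax; rewrite subr_eq0 => /eqP->.
  move/eqP: Ay; rewrite subr_eq0 => /eqP->.
  by rewrite subrr scaler0 addr0 subrr.
- move=> i; have := seg_ge0 _ _ (Bx i) (By i).
  by rewrite mulmxDr -scalemxAr mulmxBr !mxE; lra.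
- by move=> i; have := seg_ge0 _ _ (x1 i) (y1 i); rewrite !mxE.
- by move=> i; have := seg_ge0 _ _ (x2 i) (y2 i); rewrite !mxE.
- move=> i; have := y12 i; rewrite !mxE => yi.
  exact: complementary_segment (xy _) (xy _).
Unshelve. all: by end_near. Qed.

Theorem proposition1 (R : realType) (n0 m p q : nat) (hm : (0 < m)%N)
    (A : 'M[R]_(p, n0 + (m + m))) (a : 'cV[R]_p)
    (B : 'M[R]_(q, n0 + (m + m))) (b : 'cV[R]_q)
    (f : 'cV[R]_(n0 + (m + m)) -> R)
    (f_diff : forall x, differentiable f x)
    (f_convex : convex_function [set: 'cV[R]_(n0 + (m + m))] f)
    (xbar : 'cV[R]_(n0 + (m + m))) (hxbar : feasible_set A a B b xbar) :
  B_stationary f (feasible_set A a B b) xbar <->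
  local_minimizer f (feasible_set A a B b) xbar.
Proof.
split; last exact: local_minimizer_B_stationary.
apply: B_stationary_local_minimizer => //.
exact: feasible_set_segment_near.
Qed.
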